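(* Let $n\ge3$ and let $T_m$ ($m\ge 1$ an integer) be Kempf's distortion function of the Kepler manifold $X$ of complex dimension $n$. Then $T_m$ can be written in the following two forms, for $z\in X$: (1) $$T_m(z)=2^{-1}\,m^ne^{-m|x|}\sum_{j=0}^\infty(1+\tau_j)\frac{(m|x|)^{2j}}{(2j)!},$$ where $$\tau_j=1-\frac{(j+1)\cdots(j+n-2)}{(j+1/2)\cdots(j+(n-2)/2)}\longrightarrow 0\qquad\text{for }j\to\infty;$$ (2) $$T_m(z)=2m^ne^{-\xi_m}\Big(\frac1{\xi_m}\frac{\partial}{\partial\xi_m}\Big)^{n-2}\Big[\xi_m^{n-2}\big(e^{\xi_m}+(-1)^{n-2}e^{-\xi_m}+Q(\xi_m)\big)\Big],$$ where $\xi_m=m|x|$ and $Q(\xi_m)$ is a polynomial of degree $\le n-4$ in the variable $\xi_m$.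
   Context: Kepler manifold: $X=\{z\in\mathbb{C}^{n+1}\setminus\{0\}: z_1^2+\cdots+z_{n+1}^2=0\}$, a complex manifold of dimension $n$. Each $z\in X$ is written uniquely as $z=|x|e+ix$ with $e,x\in\mathbb{R}^{n+1}$, $e\cdot e=1$, $e\cdot x=0$, $x\ne0$; thus $x=\operatorname{Im}z$ and $2|x|^2=z\cdot\bar z$. The Kähler form is (up to a factor) $\omega=\frac i2\partial\bar\partial|x|$. Distortion function: for an integer $m\ge1$ let $\mathcal{H}_m$ be the Hilbert space of holomorphic functions $f$ on $X$ with $\int_X|f|^2e^{-m|x|}\,d\mu<\infty$, $d\mu=\omega^n/n!$; let $K^{(m)}$ be its reproducing kernel and $T_m(z)=e^{-m|x|}K^{(m)}(z,z)$. By the formula of Rawnsley for $m=1$ and a rescaling argument, $T_m$ is given by $$T_m(z)=2^{n-1}m^ne^{-m|x|}\sum_{j=0}^\infty\frac{(j+n-2)!}{(2j+n-2)!}\frac{(m|x|)^{2j}}{j!}.$$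
   Formalization: The printed constants contradict the given formula for T_m (n=3, |x|→0: it gives 4m³, printed (1) gives 0, (2) gives 8m³). Corrected: in (1) prefactor 2 instead of 1/2 and τ_j with opposite sign; in (2) prefactor m^n instead of 2m^n. Rawnsley's formula for T_m is assumed. *)

(* Defs.v *)
From HB Require Import structures.
From mathcomp Require Import all_boot all_order all_algebra.
From mathcomp Require Export complex.
From mathcomp Require Export all_classical all_reals all_analysis.

Set Implicit Arguments.
Unset Strict Implicit.
Unset Printing Implicit Defensive.

Import Order.TTheory GRing.Theory Num.Theory.
Import numFieldNormedType.Exports.

Local Open Scope classical_set_scope.
Local Open Scope complex_scope.
Local Open Scope ring_scope.

Section KeplerManifold.
Context {R : realType}.
Local Notation C := R[i].

Definition kepler (n : nat) : set 'rV[C]_n.+1 :=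
  [set z | z != 0 /\ \sum_i z ord0 i ^+ 2 = 0].

(* In z = |x| e + i x with e, x real one has x = Im z, so this is |x|. *)
Definition xnorm (n : nat) (z : 'rV[C]_n) : R :=
  Num.sqrt (\sum_i complex.Im (z ord0 i) ^+ 2).

(* A function on the submanifold X is holomorphic when it is locally the
   restriction of a holomorphic function on an open set of C^(n+1).  Here
   [differentiable] is over the field R[i], i.e. complex differentiability.
   Functions on X are represented by functions on C^(n+1), of which only the
   values on X are ever used. *)
Definition holomorphic_on_kepler (n : nat) (f : 'rV[C]_n.+1 -> C) : Prop :=
  forall z, kepler z ->
    exists (U : set 'rV[C : numFieldType]_n.+1)
           (F : 'rV[C : numFieldType]_n.+1 -> (C : numFieldType)^o),
      [/\ open U, U z, (forall w, U w -> differentiable F w) &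
          (forall w, U w -> kepler w -> f w = F w)].

(* Near a point with z_1 <> 0, w = (z_2, .., z_(n+1)) is a holomorphic
   coordinate on X; the point is recovered from w up to the sign b of
   z_1 = +- sqrt (- (w_1^2 + ... + w_n^2)). *)
Definition kepler_lift (n : nat) (b : bool) (w : 'rV[C]_n) : 'rV[C]_n.+1 :=
  row_mx ((-1) ^+ b * sqrtC (- \sum_i w ord0 i ^+ 2))%:M w.

(* Derivatives in the real coordinates u_j, v_j of w_j = u_j + i v_j. *)
Definition pderu (n : nat) (j : 'I_n) (phi : 'rV[C]_n -> R) (w : 'rV[C]_n) : R :=
  derive1 (fun t : R => phi (w + t%:C *: delta_mx ord0 j)) 0.
Definition pderv (n : nat) (j : 'I_n) (phi : 'rV[C]_n -> R) (w : 'rV[C]_n) : R :=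
  derive1 (fun t : R => phi (w + (0 +i* t) *: delta_mx ord0 j)) 0.

(* d^2 phi / (d w_j d conj(w_k)), expanded from
   d/dw_j = (d/du_j - i d/dv_j)/2 and d/dconj(w_k) = (d/du_k + i d/dv_k)/2. *)
Definition complex_hessian (n : nat) (phi : 'rV[C]_n -> R) (w : 'rV[C]_n) :
    'M[C]_n :=
  \matrix_(j, k)
    (((pderu j (pderu k phi) w + pderv j (pderv k phi) w) / 4) +i*
     ((pderu j (pderv k phi) w - pderv j (pderu k phi) w) / 4)).

(* For omega = c (i/2) d dbar |x|, the density of omega^n / n! with respect to
   Lebesgue measure prod_j du_j dv_j in the coordinate w.  The value of |x|
   does not depend on the sign b of the lift. *)
Definition liouville_density (n : nat) (c : R) (w : 'rV[C]_n) : R :=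
  c ^+ n * complex.Re (\det (complex_hessian (fun v => xnorm (kepler_lift false v)) w)).

(* Lebesgue integral over C^n of a nonnegative function (iterated, after
   Tonelli). *)
Fixpoint int_Cn (n : nat) : ('rV[C]_n -> \bar R) -> \bar R :=
  match n with
  | 0 => fun g => g 0
  | n'.+1 => fun g =>
      (\int[@lebesgue_measure R]_(u in setT)
         \int[@lebesgue_measure R]_(v in setT)
            int_Cn (fun w : 'rV[C]_n' => g (row_mx (u +i* v)%:M w)))%E
  end.

(* Integral over X of a nonnegative function against dmu = omega^n / n!.  The
   two lifts cover X outside the analytic subset z_1 = 0, which is mu-null. *)
Definition int_kepler (n : nat) (c : R) (g : 'rV[C]_n.+1 -> \bar R) : \bar R :=
  int_Cn (fun w : 'rV[C]_n =>
    (g (kepler_lift false w) + g (kepler_lift true w)) *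
    (liouville_density c w)%:E)%E.

Definition Rint_kepler (n : nat) (c : R) (g : 'rV[C]_n.+1 -> R) : R :=
  fine (int_kepler c (fun z => (Num.max (g z) 0)%:E)) -
  fine (int_kepler c (fun z => (Num.max (- g z) 0)%:E)).

Definition Cint_kepler (n : nat) (c : R) (g : 'rV[C]_n.+1 -> C) : C :=
  Rint_kepler c (fun z => complex.Re (g z)) +i*
  Rint_kepler c (fun z => complex.Im (g z)).

(* The weighted Bergman space H_m. *)
Definition in_Hm (n : nat) (c : R) (m : nat) (f : 'rV[C]_n.+1 -> C) : Prop :=
  holomorphic_on_kepler f /\
  (int_kepler c (fun z =>
     ((complex.Re (f z) ^+ 2 + complex.Im (f z) ^+ 2) *
      expR (- (m%:R * xnorm z)))%:E) < +oo)%E.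

Definition Hm_dot (n : nat) (c : R) (m : nat) (f g : 'rV[C]_n.+1 -> C) : C :=
  Cint_kepler c (fun z => f z * conjc (g z) * (expR (- (m%:R * xnorm z)))%:C).

Definition reproducing_kernel (n : nat) (c : R) (m : nat)
    (K : 'rV[C]_n.+1 -> 'rV[C]_n.+1 -> C) : Prop :=
  forall y, kepler y ->
    in_Hm c m (K^~ y) /\
    forall f, in_Hm c m f -> f y = Hm_dot c m f (K^~ y).

(* The reproducing kernel is unique on X, so this determines T on X. *)
Definition distortion_function (n : nat) (c : R) (m : nat)
    (T : 'rV[C]_n.+1 -> R) : Prop :=
  exists2 K, reproducing_kernel c m K &
    forall z, kepler z -> (T z)%:C = (expR (- (m%:R * xnorm z)))%:C * K z z.

End KeplerManifold.

Section Expansions.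
Context {R : realType}.

Definition rawnsley_term (n : nat) (xi : R) (j : nat) : R :=
  (j + n - 2)%N`!%:R / (2 * j + n - 2)%N`!%:R * (xi ^+ (2 * j)%N / j`!%:R).

(* T_m (z) as a function of r = |x|; it corresponds to the normalisation
   c = 1/pi of the Kaehler form. *)
Definition rawnsley_formula (n m : nat) (r : R) : R :=
  2 ^+ n.-1 * m%:R ^+ n * expR (- (m%:R * r)) *
  limn (series (rawnsley_term n (m%:R * r))).

(* The products run over k = 1, .., n - 2; the sign is the one for which
   rawnsley_term n xi j = 2^(2-n) * (1 + tau n j) * xi^(2j) / (2j)!. *)
Definition tau (n j : nat) : R :=
  (\prod_(1 <= k < n.-1) (j%:R + k%:R)) /
  (\prod_(1 <= k < n.-1) (j%:R + k%:R / 2)) - 1.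

(* The operator (1/xi) d/dxi. *)
Definition radial_derive (F : R -> R) (xi : R) : R := xi^-1 * derive1 F xi.

End Expansions.

(* Main.v *)
(* With N = n - 2, the function t^N (e^t + (-1)^N e^(-t)) is even and equals
   g(t^2) for the entire function g(s) = sum_(2p >= N) 2 s^p / (2p - N)!.  Since
   ((1/t) d/dt) g(t^2) = 2 g'(t^2), applying the operator N times gives
   2^N g^(N)(t^2), whose Taylor series is Rawnsley's, term by term.  So (2)
   holds with Q = 0. *)
Require Import Defs.
From mathcomp Require Import all_boot all_order all_algebra.
From mathcomp Require Import complex all_classical all_reals all_analysis.
From mathcomp Require Import ring lra.
Import Order.TTheory GRing.Theory Num.Theory numFieldNormedType.Exports.
Local Open Scope classical_set_scope.
Local Open Scope ring_scope.

Lemma fact_neq0 (R : realType) (m : nat) : m`!%:R != 0 :> R.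
Proof. by rewrite pnatr_eq0 -lt0n fact_gt0. Qed.

(** The real part of the equation of the cone says that Re z and Im z have equal Euclidean norms, so
    Im z = 0 would force z = 0. *)
Lemma xnorm_gt0 (R : realType) (n : nat) (z : 'rV[R[i]]_n.+1) :
  kepler z -> 0 < xnorm z.
Proof.
case=> z0 sz; rewrite /xnorm sqrtr_gt0 lt_def sumr_ge0 ?andbT; last first.
  by move=> i _; exact: sqr_ge0.
apply: contra z0; rewrite psumr_eq0 => [/allP im0|i _]; last exact: sqr_ge0.
have {}im0 i : complex.Im (z ord0 i) = 0.
  by apply/eqP; rewrite -sqrf_eq0; exact: (im0 i (mem_index_enum i)).
have : \sum_i complex.Re (z ord0 i) ^+ 2 = 0.
  apply: (@etrans _ _ (complex.Re (0 : R[i]))) => //; rewrite -sz raddf_sum.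
  apply: eq_bigr => i _; move: (im0 i); case: (z ord0 i) => a b /= ->.
  by rewrite expr2 mulr0 subr0.
move=> /eqP; rewrite psumr_eq0 => [/allP re0|i _]; last exact: sqr_ge0.
(* [z != 0] in [kepler] is elaborated as a disequality of functions of the two
   indices, not of matrices. *)
apply/eqP/funext => k; apply/funext => i; rewrite ord1; apply/eqP.
rewrite eq_complex im0 eqxx andbT.
by rewrite -sqrf_eq0; exact: (re0 i (mem_index_enum i)).
Qed.

(** * Entire power series and the operator (1/t) d/dt *)

(** Comparison with the original series at [L = 2 * |K| + 1]: since i + 1 <= 2^i, one has (i + 1)
    |K|^i <= (2 |K|)^i <= L^i <= L^(i+1). *)
Lemma is_cvg_pseries_diffs (R : realType) (a : R^nat) :
  (forall K, cvgn (pseries a K)) ->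
  forall K, cvgn (pseries (pseries_diffs a) K).
Proof.
move=> ca K; set L := 2 * `|K| + 1.
have L1 : 1 <= L by rewrite lerDr mulr_ge0.
have L0 : 0 <= L := le_trans ler01 L1.
have cL : cvgn (pseries (fun i => `|a i|) L).
  apply: is_cvg_pseries_inside_norm (ca (L + 1)) _.
  by rewrite !ger0_norm ?addr_ge0// ltrDl.
apply: normed_cvg.
apply: (@series_le_cvg _ _ (fun i => `|a i.+1| * L ^+ i.+1)) => [i|i|i|] /=.
- exact: normr_ge0.
- by rewrite mulr_ge0 ?exprn_ge0.
- rewrite /pseries_diffs !normrM normrX normr_nat mulrAC [leLHS]mulrC.
  rewrite ler_wpM2l// exprS.
  apply: (@le_trans _ _ (L ^+ i)); last by rewrite ler_peMl// exprn_ge0.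
  apply: (@le_trans _ _ ((2 * `|K|) ^+ i)).
    by rewrite exprMn ler_wpM2r ?exprn_ge0// -natrX ler_nat ltn_expl.
  by rewrite lerXn2r ?nnegrE ?mulr_ge0// lerDl.
- move/cvg_ex : cL => [l cl]; apply/cvg_ex; exists (l - `|a 0%N|).
  rewrite [X in X @ _ --> _](_ : _ =
      (fun n => pseries (fun i => `|a i|) L n.+1 - `|a 0%N|)); last first.
    apply/funext => m; rewrite /pseries /series /= big_nat_recl//= expr0 mulr1.
    by rewrite addrAC subrr add0r.
  by apply: cvgB; [rewrite (cvg_shiftS (pseries (fun i => `|a i|) L))|exact: cvg_cst].
Qed.

Lemma is_cvg_pseries_iter_diffs (R : realType) (l : nat) (a : R^nat) :
  (forall K, cvgn (pseries a K)) ->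
  forall K, cvgn (pseries (iter l (@pseries_diffs R) a) K).
Proof. by move=> ca; elim: l => //= l ih; exact: is_cvg_pseries_diffs. Qed.

Lemma iter_pseries_diffsE (R : realType) (l p : nat) (a : R^nat) :
  iter l (@pseries_diffs R) a p = (p + l)`!%:R / p`!%:R * a (p + l)%N.
Proof.
elim: l p => [|l ih] p.
  by rewrite addn0 /= divff ?mul1r// fact_neq0.
rewrite iterS /pseries_diffs ih addSnnS factS natrM invfM.
have p0 : p.+1%:R != 0 :> R by rewrite pnatr_eq0.
by rewrite !mulrA; congr (_ * _ * _); rewrite mulrAC divff ?mul1r.
Qed.

(** Chain rule, with the factor [x] isolated so that it cancels the [xi^-1] of [radial_derive]. *)
Lemma is_derive_pseries_sqr (R : realType) (a : R^nat) (x : R) :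
  (forall K, cvgn (pseries a K)) ->
  is_derive x 1 (fun t => limn (pseries a (t ^+ 2)))
    (x * (2 * limn (pseries (pseries_diffs a) (x ^+ 2)))).
Proof.
move=> ca.
have ca1 := is_cvg_pseries_diffs _ _ ca; have ca2 := is_cvg_pseries_diffs _ _ ca1.
have da : is_derive (x ^+ 2) 1 (fun s => limn (pseries a s))
    (limn (pseries (pseries_diffs a) (x ^+ 2))).
  apply: (@pseries_snd_diffs _ _ (`|x ^+ 2| + 1)) => //.
  by rewrite [ltRHS]ger0_norm ?addr_ge0// ltrDl.
have dx : is_derive x 1 (fun t : R => t ^+ 2) (2 * x).
  by apply: is_derive_eq; rewrite /GRing.scale /=; ring.
have := @is_derive1_comp _ (fun s => limn (pseries a s)) (fun t : R => t ^+ 2) _ _ _ da dx.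
by move=> d; apply: is_derive_eq; ring.
Qed.

Lemma iter_radial_derive (R : realType) (a : R^nat) (l : nat) (x : R) :
  (forall K, cvgn (pseries a K)) -> x != 0 ->
  iter l radial_derive (fun t => limn (pseries a (t ^+ 2))) x =
  2 ^+ l * limn (pseries (iter l (@pseries_diffs R) a) (x ^+ 2)).
Proof.
move=> ca; have cl k := @is_cvg_pseries_iter_diffs _ k _ ca.
elim: l x => [|l ih] x x0; first by rewrite expr0 mul1r.
rewrite iterS /radial_derive derive1E.
(* The induction hypothesis holds only away from 0, so the function is replaced on a neighbourhood
   of [x] that avoids 0. *)
rewrite (@near_eq_derive _ _ _ _ (2 ^+ l *: (fun t : R =>
  limn (pseries (iter l (@pseries_diffs R) a) (t ^+ 2))))).
- have d := is_derive_pseries_sqr _ _ x (cl l).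
  rewrite derive_val /= /GRing.scale /= [_ ^+ l.+1]exprS.
  by field.
- near=> y; rewrite ih//; near: y.
  exact: (cvgr_neq0 x cvg_id x0).
Unshelve. all: by end_near.
Qed.

(** * The even function t^N (e^t + (-1)^N e^(-t)) as a power series in t^2 *)

(** Taylor coefficients of g. Without the guard, truncated subtraction would give the spurious value
    2 / 0! when 2p < N. *)
Definition parity_coeff (R : realType) (N p : nat) : R :=
  if (N <= p.*2)%N then 2 / (p.*2 - N)`!%:R else 0.

Lemma cvg_double : n.*2 @[n --> \oo] --> \oo.
Proof.
move=> A [M _ MA]; exists M => // n /= Mn; apply: MA => /=.
by rewrite (leq_trans Mn)// -addnn leq_addr.
Qed.

Lemma cvg_pseries_parity_coeff (R : realType) (N : nat) (t : R) :
  pseries (parity_coeff R N) (t ^+ 2) @ \oo -->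
    t ^+ N * (expR t + (-1) ^+ N * expR (- t)).
Proof.
(* [v] is the expansion in powers of t, where (-1)^N (-1)^(q-N) = (-1)^q. Its odd terms vanish, so n
   terms of the series in t^2 are 2n terms of [v]. *)
pose v q : R := if (N <= q)%N then (1 + (-1) ^+ q) * t ^+ q / (q - N)`!%:R else 0.
have -> : pseries (parity_coeff R N) (t ^+ 2) = (fun n => series v n.*2).
  apply/funext; elim => [|n ih]; first by rewrite /pseries /series /= !big_geq.
  rewrite /pseries in ih *; rewrite doubleS !seriesSr ih -addrA; congr (_ + _).
  rewrite /v /parity_coeff /= -exprM mul2n -signr_odd -(signr_odd _ n.*2.+1) /=.
  rewrite odd_double /= expr0 expr1 subrr !mul0r if_same addr0.
  by case: ifP => _; rewrite ?mul0r// mulrAC.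
(* It suffices that the full sequence of partial sums of [v] converges; its first N terms are 0, and
   shifting by N aligns the rest with the exponential series. *)
apply: (cvg_comp _ _ cvg_double); rewrite -(cvg_shiftn N).
rewrite [X in X @ _ --> _](_ : _ = (fun n => t ^+ N *
    (series (exp_coeff t) n + (-1) ^+ N * series (exp_coeff (- t)) n))).
  apply: cvgM; first exact: cvg_cst.
  apply: cvgD; first exact: is_cvg_series_exp_coeff.
  by apply: cvgM; [exact: cvg_cst|exact: is_cvg_series_exp_coeff].
apply/funext; elim => [|n /= ih] /=.
  rewrite add0n /series /= [RHS](_ : _ = 0); last by rewrite !big_geq// mulr0 addr0 mulr0.
  by rewrite big_nat big1// => i /andP[_ iN]; rewrite /v leqNgt iN.
rewrite addSn !seriesSr ih /v leq_addl addnK /exp_coeff /= (exprNn t) !exprD.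
by field; rewrite fact_neq0.
Qed.

(** The preceding limit concerns only arguments that are squares; (|K| + 1)^2 is one that exceeds
    |K|, which also covers negative K. *)
Lemma is_cvg_pseries_parity_coeff (R : realType) (N : nat) (K : R) :
  cvgn (pseries (parity_coeff R N) K).
Proof.
have : cvgn (pseries (parity_coeff R N) ((`|K| + 1) ^+ 2)).
  by apply/cvg_ex; eexists; exact: cvg_pseries_parity_coeff.
move=> /is_cvg_pseries_inside; apply; rewrite [ltRHS]ger0_norm ?sqr_ge0//.
have := normr_ge0 K; nra.
Qed.

(** * The numbers [tau n j] through factorials, and their limit *)

Lemma prod_addr (R : realType) (j N : nat) :
  \prod_(1 <= k < N.+1) (j%:R + k%:R : R) = (j + N)`!%:R / j`!%:R.
Proof.
elim: N => [|N ih].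
  by rewrite big_geq// addn0 divff// fact_neq0.
rewrite big_nat_recr//= ih addnS factS natrM -natrD addnS.
by rewrite -mulrA mulrC.
Qed.

Lemma prod_addr_half (R : realType) (j N : nat) :
  \prod_(1 <= k < N.+1) (j%:R + k%:R / 2 : R) =
  (2 * j + N)`!%:R / (2 * j)`!%:R / 2 ^+ N.
Proof.
transitivity (\prod_(1 <= k < N.+1) (((2 * j)%N%:R + k%:R) * 2^-1 : R)).
  by apply: eq_bigr => k _; rewrite natrM; field.
by rewrite big_split /= prod_addr prodr_const_nat subn1 exprVn.
Qed.

Lemma tauE (R : realType) (N j : nat) :
  1 + tau N.+2 j = 2 ^+ N * ((j + N)`!%:R / (2 * j + N)`!%:R) *
    ((2 * j)`!%:R / j`!%:R) :> R.
Proof.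
rewrite /tau prod_addr prod_addr_half addrC subrK.
by field; rewrite !fact_neq0 expf_neq0.
Qed.

Lemma cvg_addr_ratio (R : realType) (a b : R) : 0 < b ->
  ((j%:R + a) / (j%:R + b) : R) @[j --> \oo] --> (1 : R).
Proof.
move=> b0; have jb0 (j : nat) : 0 < j%:R + b by rewrite ltr_wpDl.
have inv0 : ((j%:R + b)^-1 : R) @[j --> \oo] --> (0 : R).
  apply/gtr0_cvgV0; first exact: nearW.
  apply/cvgryPge => A; apply: filterS (cvgry_ge cvgr_idn A) => j /le_trans; apply.
  by rewrite lerDl ltW.
have h : 1 + (a - b) * (j%:R + b)^-1 @[j --> \oo] --> (1 : R).
  have := cvgD (cvg_cst (1 : R)) (cvgM (cvg_cst (a - b)) inv0).
  by rewrite mulr0 addr0 => H; exact: H.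
rewrite [X in X @ _ --> _](_ : _ = fun j => 1 + (a - b) * (j%:R + b)^-1)//.
by apply/funext => j; field; rewrite gt_eqF.
Qed.

(** The number of factors does not depend on j, and each ratio (j + k) / (j + k/2) tends to 1. *)
Lemma cvg_tau (R : realType) (n : nat) : (tau n j : R) @[j --> \oo] --> (0 : R).
Proof.
suff cp : \prod_(1 <= k < n.-1) ((j%:R + k%:R) / (j%:R + k%:R / 2) : R)
    @[j --> \oo] --> (1 : R).
  rewrite [X in X @ _ --> _](_ : _ = fun j : nat =>
      \prod_(1 <= k < n.-1) ((j%:R + k%:R) / (j%:R + k%:R / 2) : R) - 1).
    by have := cvgB cp (cvg_cst (1 : R)); rewrite subrr => H; exact: H.
  by apply/funext => j; rewrite /tau prodf_div.
(* The index starts at 1, so the upper bounds 0 and 1 both give an empty product. *)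
elim: n.-1 => [|[|m] ih]; try by under eq_fun do rewrite big_geq//; exact: cvg_cst.
under eq_fun do rewrite big_nat_recr//=.
have k0 : (0 : R) < m.+1%:R / 2 by rewrite divr_gt0.
by have := cvgM ih (cvg_addr_ratio R m.+1%:R _ k0); rewrite mulr1 => H; exact: H.
Qed.

(** * Identification with Rawnsley's series *)

(** Differentiating N times moves the index to j + N, where the guard holds and 2 (j + N) - N = 2j +
    N gives Rawnsley's denominator. *)
Lemma iter_diffs_parity_coeff (R : realType) (N j : nat) (x : R) :
  iter N (@pseries_diffs R) (parity_coeff R N) j * (x ^+ 2) ^+ j =
  2 * rawnsley_term N.+2 x j.
Proof.
rewrite iter_pseries_diffsE /parity_coeff /rawnsley_term.
rewrite doubleD -[N.*2]addnn -mul2n -exprM addnA leq_addl addnK.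
by rewrite !addnS !subSS !subn0; field; rewrite !fact_neq0.
Qed.

Lemma rawnsley_termE (R : realType) (N j : nat) (x : R) :
  2 ^+ N * rawnsley_term N.+2 x j =
  (1 + tau N.+2 j) * (x ^+ (2 * j)%N / (2 * j)%N`!%:R).
Proof.
rewrite tauE /rawnsley_term !addnS !subSS !subn0; field.
by rewrite !fact_neq0.
Qed.

Lemma pseries_rawnsley (R : realType) (N : nat) (x : R) :
  pseries (iter N (@pseries_diffs R) (parity_coeff R N)) (x ^+ 2) =
  (2 : R) *: series (rawnsley_term N.+2 x).
Proof.
rewrite -seriesZ /pseries; congr series; apply/funext => j.
by rewrite -[RHS]iter_diffs_parity_coeff.
Qed.

Lemma is_cvg_rawnsley (R : realType) (N : nat) (x : R) :
  cvgn (series (rawnsley_term N.+2 x)).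
Proof.
have : cvgn ((2 : R) *: series (rawnsley_term N.+2 x)).
  rewrite -pseries_rawnsley; apply: is_cvg_pseries_iter_diffs.
  exact: is_cvg_pseries_parity_coeff.
by rewrite is_cvgZlE// pnatr_eq0.
Qed.

Theorem proposition2p1 (R : realType) (n : nat) (hn : (3 <= n)%N)
    (c : R) (hc : 0 < c) (T : nat -> 'rV[R[i]]_n.+1 -> R)
    (hT : forall m : nat, (1 <= m)%N -> distortion_function c m (T m))
    (hRawnsley : forall (m : nat) (z : 'rV[R[i]]_n.+1), (1 <= m)%N ->
       kepler z -> T m z = rawnsley_formula n m (xnorm z)) :
  [/\ (forall (m : nat) (z : 'rV[R[i]]_n.+1), (1 <= m)%N -> kepler z ->
         let u : R ^nat := fun j : nat =>
           (1 + tau n j) * ((m%:R * xnorm z) ^+ (2 * j)%N / (2 * j)%N`!%:R) in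
         cvgn (series u) /\
         T m z = 2 * m%:R ^+ n * expR (- (m%:R * xnorm z)) * limn (series u)),
      ((tau n j : R) @[j --> \oo] --> (0 : R)) &
      exists Q : {poly R}, (size Q <= n - 3)%N /\
        forall (m : nat) (z : 'rV[R[i]]_n.+1), (1 <= m)%N -> kepler z ->
          let xi := m%:R * xnorm z in
          T m z = m%:R ^+ n * expR (- xi) *
            iter (n - 2) radial_derive
              (fun t : R => t ^+ (n - 2) *
                 (expR t + (-1) ^+ (n - 2) * expR (- t) + Q.[t])) xi].
Proof.
case: n hn T hT hRawnsley => [|[|N]]// _ T _ hRawnsley; split.
- move=> m z m1 zX u.
  have -> : series u = (2 ^+ N : R) *: series (rawnsley_term N.+2 (m%:R * xnorm z)).
    by rewrite -seriesZ; congr series; apply/funext => j; rewrite [RHS]rawnsley_termE.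
  split; first by apply: is_cvgZl_tmp; exact: is_cvg_rawnsley.
  rewrite limZl_tmp; last exact: is_cvg_rawnsley.
  (* Of Rawnsley's constant 2^(N+1), the factor 2^N is absorbed by 1 + tau, which leaves 2. *)
  rewrite hRawnsley// /rawnsley_formula -[N.+2.-1]/N.+1 [2 ^+ N.+1]exprS /GRing.scale /=.
  by ring.
- exact: cvg_tau.
- exists 0; split; first by rewrite size_poly0.
  move=> m z m1 zX xi.
  have xi0 : xi != 0 by rewrite mulf_neq0 ?gt_eqF ?xnorm_gt0// ltr0n.
  rewrite !subSS !subn0 [X in iter _ _ X](_ : _ =
      fun t : R => limn (pseries (parity_coeff R N) (t ^+ 2))); last first.
    apply/funext => t; rewrite horner0 addr0.
    exact/esym/cvg_lim/cvg_pseries_parity_coeff.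
  rewrite iter_radial_derive//; last exact: is_cvg_pseries_parity_coeff.
  rewrite pseries_rawnsley limZl_tmp; last exact: is_cvg_rawnsley.
  (* The N applications of the operator give 2^N and the coefficients of g give 2, which together
     account for all of 2^(N+1). *)
  rewrite hRawnsley// /rawnsley_formula -[N.+2.-1]/N.+1 [2 ^+ N.+1]exprS /GRing.scale /=.
  by ring.
Qed.
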